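(* Let $n\in\mathbb{N}$, $n-1<\alpha<n$, let $I=[a,b]$ be a finite or infinite interval and let $\psi\in C[a,b]$ be an increasing function, with continuous derivative $\psi'$, such that $\psi'(x)\neq0$ for all $x\in I$. Assume that $(f_k)_{k=1}^\infty$ is a uniformly convergent sequence of continuous functions on $[a,b]$ and that $\mathcal{D}_{a+}^{\alpha;\psi}f_k$ exists for every $k$. Moreover assume that $\left(\mathcal{D}_{a+}^{\alpha;\psi}f_k\right)_{k=1}^\infty$ converges uniformly on $[a+\varepsilon,b)$ for every $\varepsilon>0$. Then, for every $x\in(a,b)$, we have $$ \lim_{k\to\infty}\mathcal{D}_{a+}^{\alpha;\psi}f_k(x)=\mathcal{D}_{a+}^{\alpha;\psi}\lim_{k\to\infty}f_k(x). $$
   Context: For $\mu>0$ the left-sided fractional integral with respect to $\psi$ is $I_{a+}^{\mu;\psi}f(x)=\frac{1}{\Gamma(\mu)}\int_a^x\psi'(t)(\psi(x)-\psi(t))^{\mu-1}f(t)\,dt$. The $\psi$-Riemann-Liouville fractional derivative of order $\alpha$, $n-1<\alpha<n$, is $\mathcal{D}_{a+}^{\alpha;\psi}f(x)=\left(\frac{1}{\psi'(x)}\frac{d}{dx}\right)^nI_{a+}^{n-\alpha;\psi}f(x)$. *)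

(* Defs.v *)
From HB Require Import structures.
From mathcomp Require Import all_boot all_order all_algebra.
From mathcomp Require Import all_classical all_reals all_analysis.
Set Implicit Arguments.
Unset Strict Implicit.
Unset Printing Implicit Defensive.
Import Order.TTheory GRing.Theory Num.Theory.
Import numFieldNormedType.Exports.
Local Open Scope classical_set_scope.
Local Open Scope ring_scope.

Section PsiCalculus.
Context {R : realType}.
Implicit Types (a x mu alpha : R) (b : \bar R) (psi f : R -> R) (A : set R).

(* The left end point is always finite; [b = +oo] gives the half-lines
   [[a, +oo[], [[a, +oo[] and []a, +oo[] respectively. *)
Definition interval_cc a b : set R := [set x | a <= x /\ (x%:E <= b)%E].
Definition interval_co a b : set R := [set x | a <= x /\ (x%:E < b)%E].
Definition interval_oo a b : set R := [set x | a < x /\ (x%:E < b)%E].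

Definition Gamma mu : R :=
  \int[lebesgue_measure]_(t in `]0, +oo[) (t `^ (mu - 1) * expR (- t)).

(* Difference quotients taken inside [A] only: at an end point of an interval
   [A] this is the one-sided derivative. *)
Definition diff_quot psi x : R -> R := fun y => (psi y - psi x) / (y - x).
Definition derivable_within A psi x : Prop :=
  cvg (diff_quot psi x y @[y --> within A x^']).
Definition derive_within A psi x : R :=
  lim (diff_quot psi x y @[y --> within A x^']).

Definition psi_kernel psi mu f x : R -> R :=
  fun t => derive1 psi t * (psi x - psi t) `^ (mu - 1) * f t.

(* The integral is over the open interval, so only interior values of the
   (two-sided) derivative [derive1 psi] are used. *)
Definition psi_integral a psi mu f x : R :=
  (Gamma mu)^-1 * \int[lebesgue_measure]_(t in `]a, x[) psi_kernel psi mu f x t.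

Definition psi_diff psi (g : R -> R) : R -> R := fun x => derive1 g x / derive1 psi x.

Definition psiRL a psi (n : nat) alpha f : R -> R :=
  iter n (psi_diff psi) (psi_integral a psi (n%:R - alpha) f).

(* Since [Rintegral] and [derive1] are total, existence of [psiRL] on the open
   set [A] is stated separately: the fractional integral converges and can be
   differentiated [n] times by [psi_diff psi], at every point of [A]. *)
Definition psiRL_exists a psi (n : nat) alpha f A : Prop :=
  (forall x, A x ->
     lebesgue_measure.-integrable `]a, x[
       (EFin \o psi_kernel psi (n%:R - alpha) f x)) /\
  (forall j x, (j < n)%N -> A x ->
     derivable (iter j (psi_diff psi)
                  (psi_integral a psi (n%:R - alpha) f)) x 1).

End PsiCalculus.

(* Main.v *)
(* Write D = (1/psi') d/dx and F_k for the fractional integral of f_k of order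
   n - alpha, so that the derivatives of the statement are the D^n F_k.
   The weight psi'(t) (psi x - psi t)^(n - alpha - 1) is integrable on ]a, x[,
   so dominated convergence gives F_k -> F pointwise.  It remains to pass to
   the limit in D^n knowing only that F_k converges pointwise and D^n F_k
   locally uniformly; the D^n F_k need not be continuous, so nothing can be
   integrated back.  Instead, a function h has a point of any given interval
   where |D^m h| is bounded by finitely many values of |h|.  Applied to
   h = F_k - F_l with the mean value theorem, it turns uniform Cauchyness of
   D^(m+1) F_k into that of D^m F_k, and the theorem on term by term
   differentiation is then applied n times. *)
Require Import Defs.
From HB Require Import structures.
From mathcomp Require Import all_boot all_order all_algebra.
From mathcomp Require Import all_classical all_reals all_analysis.
From mathcomp Require Import measurable_realfun ring lra.
Import Order.TTheory GRing.Theory Num.Theory.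
Import numFieldNormedType.Exports.
Local Open Scope classical_set_scope.
Local Open Scope ring_scope.

(** * Cauchy estimates for real sequences *)

Lemma cvgn_cauchy {R : realType} {v : nat -> R} {e : R} : cvgn v -> 0 < e ->
  \forall N \near \oo, forall k l, (N <= k)%N -> (N <= l)%N ->
    `|v k - v l| <= e.
Proof.
move=> /cvg_ex[/= w vw] e0.
have /cvgrPdist_le/(_ _ (divr_gt0 e0 (ltr0Sn R 1)))[N _ HN] := vw.
exists N => // m Nm k l mk ml.
rewrite (splitr e) -(subrK w (v k)) -addrA (le_trans (ler_normD _ _))//.
rewrite lerD//; last by apply: HN => /=; exact: leq_trans ml.
by rewrite distrC; apply: HN => /=; exact: leq_trans mk.
Qed.

(** Provides one rank for all sample points at once; the tolerance is halved between the head and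
    the tail of [s]. *)
Lemma sum_cauchy {R : realType} (u_ : nat -> R -> R) (s : seq R) (e : R) :
  {in s, forall z, cvgn (u_ ^~ z)} -> 0 < e ->
  \forall N \near \oo, forall k l, (N <= k)%N -> (N <= l)%N ->
    \sum_(z <- s) `|u_ k z - u_ l z| <= e.
Proof.
elim: s e => [|z s IH] e us e0.
  by apply: nearW => N k l _ _; rewrite big_nil ltW.
have e20 : 0 < e / 2 by exact: divr_gt0.
near=> N => k l Nk Nl; rewrite big_cons (splitr e) lerD//.
  move: k l Nk Nl; near: N; apply: cvgn_cauchy => //.
  by apply: us; rewrite mem_head.
move: k l Nk Nl; near: N; apply: IH => // y ys.
by apply: us; rewrite inE ys orbT.
Unshelve. all: by end_near. Qed.

(** * The operator D = (1/psi') d/dx on an open interval *)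

Section PsiDiff.
Context {R : realType} {J : set R} {psi : R -> R}.
Hypotheses (openJ : open J) (itvJ : is_interval J).
Hypothesis derivable_psi : forall x, J x -> derivable psi x 1.
Hypothesis dpsi_gt0 : forall x, J x -> 0 < derive1 psi x.

Local Notation D := (psi_diff psi).

(** The derivability clause of [psiRL_exists], for an arbitrary function in place of the fractional
    integral. *)
Definition iter_derivable n (g : R -> R) :=
  forall j x, (j < n)%N -> J x -> derivable (iter j D g) x 1.

(** Put in Cauchy form because at the intermediate orders no limit function is known beforehand. *)
Definition locally_uniform_cauchy (g_ : nat -> R -> R) :=
  forall p q e, J p -> J q -> 0 < e -> \forall N \near \oo,
    forall k l, (N <= k)%N -> (N <= l)%N ->
      forall x, p <= x <= q -> `|g_ k x - g_ l x| <= e.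

Lemma psi_diffP g x : J x -> derive1 g x = D g x * derive1 psi x.
Proof. by move=> Jx; rewrite /psi_diff divfK// gt_eqF ?dpsi_gt0. Qed.

Lemma near_eq_psi_diff {f g : R -> R} (x : R) :
  (\forall y \near x, f y = g y) -> D f x = D g x.
Proof. by move=> fg; rewrite /psi_diff !derive1E (near_eq_derive _ fg). Qed.

Lemma psi_diffB (f g : R -> R) x : derivable f x 1 -> derivable g x 1 ->
  D (fun t => f t - g t) x = D f x - D g x.
Proof.
by move=> df dg; rewrite /psi_diff !derive1E (deriveB df dg) mulrBl.
Qed.

(** [D] sees only the germ of a function at a point. As [J] is open, the identity at order [j] holds
    near each point of [J] and can be differentiated once more. *)
Lemma iter_psi_diffB {n f g} : iter_derivable n f -> iter_derivable n g ->
  forall j x, (j <= n)%N -> J x ->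
  iter j D (fun t => f t - g t) x = iter j D f x - iter j D g x.
Proof.
move=> df dg; elim=> // j IH x jn Jx; rewrite !iterS.
rewrite -psi_diffB; [|exact: df|exact: dg].
apply: near_eq_psi_diff; near=> y; apply: IH; first exact: ltnW.
by near: y; exact: openJ.
Unshelve. all: by end_near. Qed.

Lemma iter_derivableB {n f g} : iter_derivable n f -> iter_derivable n g ->
  iter_derivable n (fun t => f t - g t).
Proof.
move=> df dg j x jn Jx.
apply: (near_eq_derivable (f := fun y => iter j D f y - iter j D g y)).
  near=> y; apply/esym/(iter_psi_diffB df dg); first exact: ltnW.
  by near: y; exact: openJ.
by apply: derivableB; [exact: df|exact: dg].
Unshelve. all: by end_near. Qed.

Lemma derivable_itv_continuous {g : R -> R} {x y} : J x -> J y ->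
  (forall z, J z -> derivable g z 1) -> {within `[x, y], continuous g}.
Proof.
move=> Jx Jy dg; apply: derivable_within_continuous => z.
by rewrite in_itv => zxy; apply/dg/(itvJ _ _ Jx Jy).
Qed.

Lemma psi_increasing {x y} : J x -> J y -> x < y -> psi x < psi y.
Proof.
move=> Jx Jy xy.
have [z|c] := MVT (f := psi) (df := derive1 psi) xy _
  (derivable_itv_continuous Jx Jy derivable_psi).
  rewrite in_itv => /andP[xz zy].
  have Jz : J z by apply: (itvJ _ _ Jx Jy); rewrite !ltW.
  by rewrite derive1E; exact/derivableP/derivable_psi.
rewrite in_itv => /andP[xc cy] E; rewrite -subr_gt0 E mulr_gt0 ?subr_gt0//.
by apply/dpsi_gt0/(itvJ _ _ Jx Jy); rewrite !ltW.
Qed.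

(** Cauchy's mean value theorem for the pair [g], [psi]: the ratio of the two derivatives at the
    intermediate point is [D g]. *)
Lemma psi_diff_MVT {g : R -> R} {x y} : (forall z, J z -> derivable g z 1) ->
  J x -> J y -> x < y ->
  exists2 c, x < c < y & g y - g x = D g c * (psi y - psi x).
Proof.
move=> dg Jx Jy xy.
have [||z|z|z|c] := cauchy_MVT (f := g) (df := derive1 g) (g := psi)
    (dg := derive1 psi) xy.
- exact: derivable_itv_continuous.
- exact: derivable_itv_continuous.
- rewrite in_itv => /andP[xz zy]; rewrite derive1E.
  by apply/derivableP/dg/(itvJ _ _ Jx Jy); rewrite !ltW.
- rewrite in_itv => /andP[xz zy]; rewrite derive1E.
  by apply/derivableP/derivable_psi/(itvJ _ _ Jx Jy); rewrite !ltW.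
- rewrite in_itv => /andP[xz zy]; rewrite gt_eqF//.
  by apply/dpsi_gt0/(itvJ _ _ Jx Jy); rewrite !ltW.
rewrite in_itv => xcy E; exists c => //.
by rewrite /psi_diff E divfK// gt_eqF// subr_gt0 psi_increasing.
Qed.

Lemma psi_diff_le {g : R -> R} {p q M x y} :
  (forall z, J z -> derivable g z 1) ->
  J p -> J q -> (forall z, p <= z <= q -> `|D g z| <= M) ->
  p <= x <= q -> p <= y <= q ->
  `|g y - g x| <= M * `|psi y - psi x|.
Proof.
move=> dg Jp Jq gM.
wlog xy : x y / x < y.
  move=> H px py; have [xy|yx|<-] := ltgtP x y; first exact: H.
    by rewrite distrC (distrC (psi y)); exact: H.
  by rewrite !subrr normr0 mulr0.
move=> /andP[px xq] /andP[py yq].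
have Jx : J x by apply: (itvJ _ _ Jp Jq); rewrite px.
have Jy : J y by apply: (itvJ _ _ Jp Jq); rewrite py.
have [c /andP[xc cy] ->] := psi_diff_MVT dg Jx Jy xy.
rewrite normrM ler_wpM2r// gM// (le_trans px (ltW xc)).
exact: le_trans (ltW cy) yq.
Qed.

(* The sample points come from splitting [[p, q]] in thirds and bounding a
   difference quotient of [D^n h] between points of the outer thirds. *)
Lemma iter_psi_diff_sample n {p q} : J p -> J q -> p < q ->
  exists (s : seq R) (C : R), [/\ 0 <= C, {in s, forall z, J z} &
    forall h, iter_derivable n h -> exists2 c, p < c < q &
      `|iter n D h c| <= C * \sum_(z <- s) `|h z|].
Proof.
elim: n p q => [|n IH] p q Jp Jq pq.
  have pmq : p < (p + q) / 2 < q by rewrite !midf_lt.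
  exists [:: (p + q) / 2], 1; split => //.
    move=> z; rewrite inE => /eqP ->; apply: (itvJ _ _ Jp Jq).
    by move: pmq => /andP[? ?]; rewrite !ltW.
  by move=> h _; exists ((p + q) / 2) => //=; rewrite big_seq1 mul1r.
pose p' := p + (q - p) / 3; pose q' := q - (q - p) / 3.
have [pp' p'q' q'q] : [/\ p < p', p' < q' & q' < q].
  by rewrite /p' /q'; split; lra.
have Jp' : J p' by apply: (itvJ _ _ Jp Jq); rewrite !ltW// (lt_trans p'q').
have Jq' : J q' by apply: (itvJ _ _ Jp Jq); rewrite !ltW// (lt_trans pp').
have [s1 [C1 [C1_ge0 Js1 H1]]] := IH p p' Jp Jp' pp'.
have [s2 [C2 [C2_ge0 Js2 H2]]] := IH q' q Jq' Jq q'q.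
have psi_gt0 : 0 < psi q' - psi p' by rewrite subr_gt0 psi_increasing.
(* [C1] and [C2] control the two end values of the increment of [D^n h]; the increment of [psi]
   between points of the outer thirds is at least the one over the middle third. *)
exists (s1 ++ s2), ((C1 + C2) / (psi q' - psi p')); split.
- by apply: divr_ge0; [exact: addr_ge0|exact: ltW].
- by move=> z; rewrite mem_cat => /orP[/Js1|/Js2].
move=> h dh.
have dhn : iter_derivable n h by move=> j x jn; apply: dh; exact: ltnW.
have [c1 /andP[pc1 c1p'] Hc1] := H1 h dhn.
have [c2 /andP[q'c2 c2q] Hc2] := H2 h dhn.
have c1q : c1 < q by rewrite (lt_trans c1p')// (lt_trans p'q').
have pc2 : p < c2 by rewrite (lt_trans pp')// (lt_trans p'q').
have Jc1 : J c1 by apply: (itvJ _ _ Jp Jq); rewrite !ltW.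
have Jc2 : J c2 by apply: (itvJ _ _ Jp Jq); rewrite !ltW.
have c12 : c1 < c2 by rewrite (lt_trans c1p')// (lt_trans p'q').
have dhD z : J z -> derivable (iter n D h) z 1 by exact: dh.
have [c /andP[c1c cc2] E] := psi_diff_MVT dhD Jc1 Jc2 c12.
exists c; first by rewrite (lt_trans pc1)//= (lt_trans cc2).
have le_psi : psi q' - psi p' <= psi c2 - psi c1.
  by apply: lerB; exact/ltW/psi_increasing.
rewrite iterS mulrAC ler_pdivlMr//.
apply: (@le_trans _ _ `|iter n D h c2 - iter n D h c1|).
  rewrite E (normrM (D _ c)) ler_wpM2l// ger0_norm//.
  exact: le_trans (ltW psi_gt0) _.
rewrite big_cat/= (le_trans (ler_normB _ _))//.
have S_ge0 (s : seq R) : 0 <= \sum_(z <- s) `|h z| by exact: sumr_ge0.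
rewrite mulrDr 2!mulrDl.
have := mulr_ge0 C1_ge0 (S_ge0 s2); have := mulr_ge0 C2_ge0 (S_ge0 s1).
lra.
Qed.

(** For [h = u_k - u_l], sampling makes [D^n h] small at one point [c], and the bound on [D^(n+1) h]
    carries this to the whole interval through [psi_diff_le]. Each contribution gets half of [e]. *)
Lemma iter_psi_diff_cauchy n (u_ : nat -> R -> R) :
  (forall k, iter_derivable n.+1 (u_ k)) ->
  (forall x, J x -> cvgn (u_ ^~ x)) ->
  locally_uniform_cauchy (fun k => iter n.+1 D (u_ k)) ->
  locally_uniform_cauchy (fun k => iter n D (u_ k)).
Proof.
move=> du cu cDu p q e Jp Jq e0.
(* [p = q] is allowed, whereas sampling takes an interval of positive length; hence the enlargement
   to [[p, q1]]. *)
have [q1 Jq1 qq1] : exists2 q1, J q1 & q < q1.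
  near q^'+ => q1; exists q1; last by [].
  by near: q1; exact/cvg_within/openJ.
have [pq1|q1p] := ltP p q1; last first.
  apply: nearW => N k l _ _ x /andP[px xq].
  by have := lt_le_trans (le_lt_trans xq qq1) (le_trans q1p px); rewrite ltxx.
have [s [C [C0 Js HC]]] := iter_psi_diff_sample n Jp Jq1 pq1.
have M0 : 0 < psi q1 - psi p by rewrite subr_gt0 psi_increasing.
have d0 : 0 < e / 2 / (psi q1 - psi p) by rewrite !divr_gt0.
(* [C] may vanish, so the division is by [C + 1]. *)
have C10 : 0 < C + 1 by rewrite ltr_wpDl.
have e10 : 0 < e / 2 / (C + 1) by rewrite !divr_gt0.
near=> N => k l Nk Nl x /andP[px xq].
have px1 : p <= x <= q1 by rewrite px ltW// (le_lt_trans xq).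
have Jx : J x by exact: (itvJ _ _ Jp Jq1).
have dh := iter_derivableB (du k) (du l).
have [c /andP[pc cq1] Hc] := HC _ (fun j x jn => dh j x (ltnW jn)).
have pc1 : p <= c <= q1 by rewrite !ltW.
rewrite -(iter_psi_diffB (du k) (du l))//.
have dhn z : J z -> derivable (iter n D (fun t => u_ k t - u_ l t)) z 1.
  exact: dh.
have hM z : p <= z <= q1 ->
    `|D (iter n D (fun t => u_ k t - u_ l t)) z| <= e / 2 / (psi q1 - psi p).
  move=> pz; have Jz : J z by exact: (itvJ _ _ Jp Jq1).
  rewrite -iterS (iter_psi_diffB (du k) (du l))//.
  by move: k l Nk Nl z pz {Jz dh Hc dhn}; near: N; exact: cDu.
rewrite -(subrK (iter n D (fun t => u_ k t - u_ l t) c)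
  (iter n D (fun t => u_ k t - u_ l t) x)).
rewrite (le_trans (ler_normD _ _))// (splitr e) lerD//.
  apply: le_trans (psi_diff_le dhn Jp Jq1 hM pc1 px1) _.
  rewrite mulrAC ler_pdivrMr// ler_wpM2l ?divr_ge0 ?(ltW e0)//.
  have psi_mono z y : p <= z -> z <= y -> y <= q1 -> psi z <= psi y.
    move=> pz; rewrite le_eqVlt => /predU1P[->//|zy] yq.
    apply/ltW/psi_increasing => //; apply: (itvJ _ _ Jp Jq1).
      by rewrite pz (le_trans (ltW zy)).
    by rewrite yq (le_trans pz (ltW zy)).
  rewrite ler_norml; apply/andP; split.
    rewrite opprB lerB// ?psi_mono ?(ltW pc) ?(ltW cq1)//.
    by case/andP: px1.
  by rewrite lerB// psi_mono ?(ltW pc) ?(ltW cq1)//; case/andP: px1.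
apply: le_trans Hc _.
have HN : \sum_(z <- s) `|u_ k z - u_ l z| <= e / 2 / (C + 1).
  move: k l Nk Nl {dh dhn hM}; near: N; apply: sum_cauchy => // z zs.
  exact/cu/Js.
apply: le_trans (ler_wpM2l C0 HN) _.
by rewrite mulrCA ler_piMr ?divr_ge0 ?(ltW e0)// ler_pdivrMr// mul1r lerDl.
Unshelve. all: by end_near. Qed.

(** The mean value estimate for [g_N - g_l], with [l] tending to infinity, compares the increments
    of [g_N] and [g] from [x]. Only difference quotients occur, so the derivatives may be
    discontinuous. *)
Lemma psi_diff_limit (g_ : nat -> R -> R) (g : R -> R) :
  (forall k x, J x -> derivable (g_ k) x 1) ->
  (forall x, J x -> g_ ^~ x @ \oo --> g x) ->
  locally_uniform_cauchy (fun k => D (g_ k)) ->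
  forall x, J x ->
    derivable g x 1 /\ (fun k => D (g_ k) x) @ \oo --> D g x.
Proof.
move=> dg gg cDg x Jx.
(* The Cauchy condition is used on the degenerate interval [[x, x]], at [e / 2] to obtain a strict
   inequality. *)
have /cvg_ex[/= L HL] : cvgn (fun k => D (g_ k) x).
  apply/cauchy_cvgP/cauchy_exP => /= e e0.
  have [N _ HN] := cDg x x _ Jx Jx (divr_gt0 e0 (ltr0Sn R 1)).
  exists (D (g_ N) x); exists N => // k Nk; rewrite /ball_ /=.
  apply: le_lt_trans (HN N (leqnn N) N k (leqnn N) Nk x _) _.
    by rewrite lexx.
  by rewrite ltr_pdivrMr// ltr_pMr// ltr1n.
have quotP (f : R -> R) : derivable f x 1 ->
    h^-1 *: (f (h *: 1 + x) - f x) @[h --> 0^'] --> derive1 f x.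
  by move=> df; rewrite derive1E; exact: df.
(* The ordinary derivative of [g] should be [L] times that of [psi]; division by the latter then
   gives [D g x = L]. *)
have quot_g : h^-1 *: (g (h *: 1 + x) - g x) @[h --> 0^'] -->
    L * derive1 psi x.
  apply/cvgrPdist_le => e e0.
  have psi'0 := dpsi_gt0 _ Jx.
  (* [M] dominates both [derive1 psi x] and the nearby difference quotients of [psi]. *)
  pose M := derive1 psi x + 1; have M0 : 0 < M by rewrite addr_gt0.
  have e3 : 0 < e / 3 by exact: divr_gt0.
  have e1 : 0 < e / 3 / M by exact: divr_gt0.
  have [p Jp px] : exists2 p, J p & p < x.
    near x^'- => p; exists p; last by [].
    by near: p; exact/cvg_within/openJ.
  have [q Jq xq] : exists2 q, J q & x < q.
    near x^'+ => q; exists q; last by [].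
    by near: q; exact/cvg_within/openJ.
  have [N [HN HL3]] : exists N, (forall l, (N <= l)%N -> forall z,
      p <= z <= q -> `|D (g_ N) z - D (g_ l) z| <= e / 3 / M) /\
      `|L - D (g_ N) x| <= e / 3 / M.
    have [N1 _ HN1] := cDg p q _ Jp Jq e1.
    have /cvgrPdist_le/(_ _ e1)[N2 _ HN2] := HL.
    exists (maxn N1 N2); split; last by apply: HN2; exact: leq_maxr.
    by move=> l; apply: HN1 (leqnn _); exact: leq_maxl.
  have gN y : p <= y <= q ->
      `|(g_ N y - g_ N x) - (g y - g x)| <= e / 3 / M * `|psi y - psi x|.
    move=> py; have Jy : J y by exact: (itvJ _ _ Jp Jq).
    have lim_y : `|(g_ N y - g_ N x) - (g_ l y - g_ l x)| @[l --> \oo] -->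
        `|(g_ N y - g_ N x) - (g y - g x)|.
      apply: cvg_norm; apply: cvgB; first exact: cvg_cst.
      by apply: cvgB; exact: gg.
    apply: (cvgr_to_le lim_y); exists N => // l Nl.
    rewrite (_ : _ - _ = (g_ N y - g_ l y) - (g_ N x - g_ l x)); last by ring.
    have px' : p <= x <= q by rewrite !ltW.
    apply: (psi_diff_le (g := fun t => g_ N t - g_ l t) _ Jp Jq _ px' py).
      by move=> z Jz; apply: derivableB; exact: dg.
    move=> z pz; have Jz : J z by exact: (itvJ _ _ Jp Jq).
    by rewrite psi_diffB; [exact: HN|exact: dg|exact: dg].
  have quot_psi := quotP _ (derivable_psi _ Jx).
  have quot_N := quotP _ (dg N x Jx).
  near=> h.
  have h0 : h != 0 by near: h; exact: nbhs_dnbhs_neq.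
  have py : p <= h *: 1 + x <= q.
    rewrite [h *: 1]mulr1; near: h; apply: cvg_within.
    exists (Num.min (x - p) (q - x)) => /=.
      by rewrite lt_min !subr_gt0 px.
    by move=> h /=; rewrite sub0r normrN lt_min !ltr_norml; lra.
  have psi_M : `|h^-1 *: (psi (h *: 1 + x) - psi x)| <= M.
    near: h; apply: (cvgr_norm_le _ quot_psi).
    by rewrite gtr0_norm// ltrDl.
  have N3 : `|derive1 (g_ N) x - h^-1 *: (g_ N (h *: 1 + x) - g_ N x)| <= e / 3.
    near: h; move/cvgrPdist_le : quot_N; exact.
  set y := h *: 1 + x in py psi_M N3 *.
  (* Three errors of at most [e / 3]: [L] against rank [N], the derivative of [g_N] against its
     quotient, and the quotient of [g_N] against that of [g]. *)
  rewrite (_ : _ - _ = (L - D (g_ N) x) * derive1 psi x +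
     (derive1 (g_ N) x - h^-1 *: (g_ N y - g_ N x)) +
     h^-1 *: ((g_ N y - g_ N x) - (g y - g x))); last first.
    by rewrite (psi_diffP (g_ N) _ Jx) /GRing.scale/=; ring.
  rewrite (_ : e = e / 3 + e / 3 + e / 3); last by lra.
  rewrite (le_trans (ler_normD _ _))// lerD//.
    rewrite (le_trans (ler_normD _ _))// lerD//.
    rewrite normrM (gtr0_norm psi'0).
    apply: (@le_trans _ _ (e / 3 / M * M)); last by rewrite divfK// gt_eqF.
    by rewrite ler_pM// ?lerDl// ltW.
  rewrite normrZ; apply: le_trans (ler_wpM2l _ (gN _ py)) _ => //.
  rewrite mulrCA -normrZ.
  apply: (@le_trans _ _ (e / 3 / M * M)); last by rewrite divfK// gt_eqF.
  by rewrite ler_wpM2l// ltW.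
split; first exact: cvgP quot_g.
have derive1_g : derive1 g x = L * derive1 psi x.
  by rewrite derive1E; exact: cvg_lim quot_g.
have -> : D g x = L by rewrite /psi_diff derive1_g mulfK// gt_eqF ?dpsi_gt0.
exact: HL.
Unshelve. all: by end_near. Qed.

(** By induction: [iter_psi_diff_cauchy] lowers the Cauchy hypothesis by one order, so that the
    induction hypothesis applies, and [psi_diff_limit] then recovers the top order. *)
Lemma iter_psi_diff_limit n (u_ : nat -> R -> R) (u : R -> R) :
  (forall k, iter_derivable n (u_ k)) ->
  (forall x, J x -> u_ ^~ x @ \oo --> u x) ->
  locally_uniform_cauchy (fun k => iter n D (u_ k)) ->
  iter_derivable n u /\
  forall x, J x -> (fun k => iter n D (u_ k) x) @ \oo --> iter n D u x.
Proof.
elim: n => [|n IH] du uu cDu; first by split=> // j x; rewrite ltn0.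
have [||dun un] := IH _ uu.
- by move=> k j x jn; apply: du; exact: ltnW.
- apply: iter_psi_diff_cauchy => // x Jx.
  by apply: cvgP; exact: uu.
have limD := psi_diff_limit _ _ (fun k x => du k n x (ltnSn n)) un cDu.
split; last by move=> x /limD[].
move=> j x; rewrite ltnS leq_eqVlt => /predU1P[->|jn] Jx; last exact: dun.
by have [] := limD x Jx.
Qed.

End PsiDiff.

(** * Derivatives within a set at interior points *)

Section DerivativeWithin.
Context {R : realType} {A : set R} {psi : R -> R} {x : R}.
Hypothesis nbhsA : nbhs x A.

(** Near an interior point the restriction to [A] is void; the substitution [y = x + h] matches the
    two forms of the difference quotient. *)
Lemma derivable_within_interior : derivable_within A psi x ->
  is_derive x 1 psi (derive_within A psi x).
Proof.
move=> dpsi.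
suff H : h^-1 *: (psi (h *: 1 + x) - psi x) @[h --> 0^'] -->
    derive_within A psi x.
  apply: DeriveDef; first exact: cvgP H.
  exact: cvg_lim H.
apply/cvgrPdist_le => e e0; move/cvgrPdist_le : dpsi => /(_ _ e0).
move: nbhsA => [d1 /= d10 d1A] [d2 /= d20 Hd].
exists (Num.min d1 d2) => /=; first by rewrite lt_min d10.
move=> h /=; rewrite sub0r normrN lt_min => /andP[hd1 hd2] h0.
have E : x - (h + x) = - h by ring.
rewrite [h *: 1]mulr1 [_ *: _]mulrC.
have := Hd (h + x); rewrite /diff_quot addrK; apply.
- by rewrite /= E normrN.
- by rewrite -subr_eq0 addrK.
- by apply: d1A; rewrite /= E normrN.
Qed.

End DerivativeWithin.

(** * Integrability of the kernel and convergence of fractional integrals *)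

Section Kernel.
Context {R : realType} {a x mu : R} {psi dpsi : R -> R}.
Hypotheses (ax : a < x) (mu0 : 0 < mu).
Hypothesis psi_cont : {within `[a, x], continuous psi}.
Hypothesis dpsi_cont : {within `[a, x], continuous dpsi}.
Hypothesis psi_dpsi : forall t, a < t < x -> is_derive t 1 psi (dpsi t).
Hypothesis dpsi_ge0 : forall t, a < t < x -> 0 <= dpsi t.
Hypothesis psi_lt : forall t, a <= t < x -> psi t < psi x.

(** The kernel for the constant function 1, written with [dpsi], whose continuity extends to the end
    point [a]. *)
Let k t := dpsi t * (psi x - psi t) `^ (mu - 1).
(** An antiderivative of [k] between [a] and [x], normalized to be at most 0. *)
Let F t := - (psi x - psi t) `^ mu / mu.

Lemma is_derive_powRB (r v : R) : v < psi x ->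
  is_derive v 1 (fun w => (psi x - w) `^ r) (- (r * (psi x - v) `^ (r - 1))).
Proof.
move=> vx; rewrite -[X in is_derive _ _ _ X]mulrN1.
apply: (is_derive1_comp (f := fun w => w `^ r) (g := fun w => psi x - w)).
  by apply: is_derive1_powR; rewrite subr_gt0.
by rewrite -[-1]add0r; apply: is_deriveB.
Qed.

(** [A] avoids [x], so the base stays positive and the power is continuous whatever the sign of
    [r]. *)
Lemma within_continuous_powRB (r : R) (A : set R) : A `<=` `[a, x[ ->
  {within A, continuous (fun t => (psi x - psi t) `^ r)}.
Proof.
move=> Aax; apply: (within_continuous_comp _ psi (fun w => (psi x - w) `^ r)).
  move=> v; rewrite inE => -[t At <-].
  have := Aax _ At; rewrite /= in_itv /= => /psi_lt tx.
  have [d _] := is_derive_powRB r _ tx.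
  by apply: differentiable_continuous; apply/derivable1_diffP.
apply: continuous_subspaceW psi_cont => t /Aax.
by rewrite /= !in_itv/= => /andP[-> /ltW].
Qed.

Lemma within_continuous_kernel (A : set R) : A `<=` `[a, x[ ->
  {within A, continuous k}.
Proof.
move=> Aax t; apply: (@continuousM _ (subspace A) dpsi
  (fun u => (psi x - psi u) `^ (mu - 1))); last exact: within_continuous_powRB.
move: t; apply: continuous_subspaceW dpsi_cont => t /Aax.
by rewrite /= !in_itv/= => /andP[-> /ltW].
Qed.

Lemma is_derive_primitive t : a < t < x -> is_derive t 1 F (k t).
Proof.
move=> /andP[at_ tx].
have psit : psi t < psi x by rewrite psi_lt// ltW.
have := is_derive1_comp (is_derive_powRB mu _ psit) (psi_dpsi t _).
rewrite at_ tx => /(_ isT) H.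
have := is_deriveZ (- mu^-1) H.
rewrite (_ : _ *: _ = k t); last first.
  by rewrite /k /GRing.scale/=; field; rewrite gt_eqF.
congr is_derive; apply/funext => u.
by rewrite /F [RHS]mulNr -mulrN mulrC.
Qed.

(** The fundamental theorem of calculus on [[a, y]], where [k] is continuous, gives [F y - F a], and
    [F y <= 0]. The resulting bound is independent of [y]. *)
Lemma integral_kernel_le y : a < y < x ->
  (\int[lebesgue_measure]_(t in `]a, y[) (k t)%:E <= (- F a)%:E)%E.
Proof.
move=> /andP[ay yx].
have sub : `[a, y] `<=` `[a, x[.
  by move=> t; rewrite /= !in_itv/= => /andP[-> /le_lt_trans->].
have kc := within_continuous_kernel _ sub.
have Fc : {within `[a, y], continuous F}.
  move=> t; apply: (@continuousM _ (subspace `[a, y])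
    (fun u => - (psi x - psi u) `^ mu) (fun=> mu^-1)).
    apply: (@continuousN _ _ (subspace `[a, y])).
    exact: within_continuous_powRB.
  exact: cst_continuous.
have mk (A : set R) : measurable A -> A `<=` `[a, y] -> measurable_fun A k.
  move=> mA Aay; apply: subspace_continuous_measurable_fun => //.
  exact: continuous_subspaceW kc.
have [cF Fa Fy] := (continuous_within_itvP F ay).1 Fc.
have dF : derivable_oo_LRcontinuous F a y.
  split=> // t; rewrite in_itv/= => /andP[at_ ty].
  have atx : a < t < x by rewrite at_ (lt_trans ty).
  by have [] := is_derive_primitive t atx.
have Fk : {in `]a, y[, derive1 F =1 k}.
  move=> t; rewrite in_itv/= => /andP[at_ ty]; rewrite derive1E.
  have atx : a < t < x by rewrite at_ (lt_trans ty).
  by have [_ ->] := is_derive_primitive t atx.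
rewrite integral_itv_bndo_bndc; last first.
  apply/measurable_EFinP; apply: mk; first exact: measurable_itv.
  exact: subset_itv_oo_cc.
rewrite integral_itv_obnd_cbnd; last first.
  apply/measurable_EFinP; apply: mk; first exact: measurable_itv.
  exact: subset_itv_oc_cc.
rewrite (continuous_FTC2 ay kc dF Fk) -EFinB lee_fin gerDr.
by rewrite /F mulNr oppr_le0 divr_ge0 ?powR_ge0// ltW.
Qed.

(** [k] is nonnegative and its integrals over []a, y[] are bounded uniformly in [y < x]; monotone
    convergence along an exhaustion of []a, x[] makes the integral finite. *)
Lemma psi_kernel1_integrable : lebesgue_measure.-integrable `]a, x[
  (EFin \o psi_kernel psi mu (fun=> 1) x).
Proof.
have kE : {in `]a, x[%classic,
    EFin \o k =1 EFin \o psi_kernel psi mu (fun=> 1) x}.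
  move=> t; rewrite inE/= in_itv/= => atx; rewrite /psi_kernel mulr1 derive1E.
  by have [_ ->] := psi_dpsi t atx.
apply: (@eq_integrable _ _ _ lebesgue_measure _ _ (EFin \o k)).
- exact: measurable_itv.
- exact: kE.
have sub : `]a, x[ `<=` `[a, x[ by exact: subset_itv_oo_co.
have mk : measurable_fun `]a, x[ k.
  apply: subspace_continuous_measurable_fun => //.
  exact: within_continuous_kernel.
have k0 t : a < t < x -> 0 <= k t.
  by move=> tx; rewrite mulr_ge0 ?powR_ge0 ?dpsi_ge0.
apply/integrableP; split; first exact/measurable_EFinP.
rewrite (_ : integral _ _ _ = \int[lebesgue_measure]_(t in `]a, x[) (k t)%:E)%E.
  (* The denominator starts at 2, which puts [y 0] already strictly between [a] and [x]. *)
  pose y n : R := x - (x - a) / n.+2%:R.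
  have ynd n m : (n <= m)%N -> y n <= y m.
    move=> nm; rewrite lerD2l lerN2 ler_wpM2l ?subr_ge0 ?(ltW ax)//.
    by rewrite lef_pV2 ?posrE// ler_nat.
  have xa n : 0 < (x - a) / n.+2%:R < x - a.
    by rewrite divr_gt0 ?subr_gt0//= ltr_pdivrMr// ltr_pMr ?subr_gt0// ltr1n.
  have yx n : a < y n < x by have := xa n; rewrite /y; move: (_ / _) => z; lra.
  have cupE : \bigcup_n `]a, y n[%classic = `]a, x[%classic.
    rewrite eqEsubset; split => t.
      move=> [n _] /=; rewrite !in_itv/= => /andP[-> /lt_trans]; apply.
      by case/andP: (yx n).
    rewrite /= in_itv/= => /andP[at_ tx].
    (* [t < y n] amounts to [(x - a) / (x - t) < n + 2]. *)
    pose n := Num.truncn ((x - a) / (x - t)).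
    exists n => //=; rewrite in_itv/= at_ /= ltrBrDl -ltrBrDr.
    have xt : 0 < x - t by rewrite subr_gt0.
    rewrite ltr_pdivrMr// mulrC -ltr_pdivrMr//.
    apply: lt_trans (truncnS_gt _) _.
    by rewrite ltr_nat.
  have cvgI := @ge0_nondecreasing_set_cvg_integral _ (measurableTypeR R) _
    (fun n => `]a, y n[%classic) (EFin \o k) lebesgue_measure.
  rewrite -cupE; apply: (@le_lt_trans _ _ (- F a)%:E); last exact: ltry.
  apply: (cvge_to_le (cvgI _ _ _ _)).
  - move=> n m nm; rewrite subsetEset => t /=.
    rewrite !in_itv/= => /andP[-> tn].
    exact: lt_le_trans tn (ynd _ _ nm).
  - by move=> n; exact: measurable_itv.
  - move=> n; apply/measurable_EFinP.
    apply: (measurable_funS (measurable_itv _) _ mk) => t /=.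
    rewrite !in_itv/= => /andP[-> /lt_trans]; apply.
    by case/andP: (yx n).
  - move=> n t /=; rewrite in_itv/= lee_fin => /andP[at_ ty].
    by apply: k0; rewrite at_ (lt_trans ty)//; case/andP: (yx n).
  - by apply: nearW => n; exact: integral_kernel_le.
apply: eq_integral => t; rewrite inE/= in_itv/= => /k0 kt.
by rewrite /= ger0_norm.
Qed.

End Kernel.

(** Dominated convergence, the dominating function being [M] times the absolute value of the kernel
    for the constant 1. *)
Lemma psi_integral_cvg {R : realType} {a x mu M : R} {psi f : R -> R}
    {f_ : nat -> R -> R} {N : nat} :
  lebesgue_measure.-integrable `]a, x[
    (EFin \o psi_kernel psi mu (fun=> 1) x) ->
  (forall k, lebesgue_measure.-integrable `]a, x[
    (EFin \o psi_kernel psi mu (f_ k) x)) ->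
  (forall t, a < t < x -> f_ ^~ t @ \oo --> f t) ->
  (forall k t, (N <= k)%N -> a < t < x -> `|f_ k t| <= M) ->
  lebesgue_measure.-integrable `]a, x[ (EFin \o psi_kernel psi mu f x) /\
  psi_integral a psi mu (f_ k) x @[k --> \oo] --> psi_integral a psi mu f x.
Proof.
move=> int1 int_ fcvg fM.
(* The bound [M] is available from rank [N] on; the shift makes it hold at every index. *)
pose g_ k := EFin \o psi_kernel psi mu (f_ (k + N)%N) x.
pose K1 := EFin \o psi_kernel psi mu (fun=> 1) x.
pose g t := (M%:E * `|K1 t|)%E.
have g_cvg t : a < t < x -> g_ ^~ t @ \oo --> (EFin \o psi_kernel psi mu f x) t.
  move=> tx; apply: cvg_EFin; first by apply: nearW.
  rewrite /g_ /comp /=; apply: cvgMr.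
  by have := fcvg t tx; rewrite -(cvg_shiftn N).
have mg_ n : measurable_fun `]a, x[ (g_ n).
  by have /integrableP[] := int_ (n + N)%N.
have [||||||intf _ cvgf] := @dominated_convergence _ (measurableTypeR R) _
    lebesgue_measure `]a, x[%classic _ g_ (EFin \o psi_kernel psi mu f x) g.
- by [].
- by [].
- exact: (emeasurable_fun_cvg g_).
- by apply: aeW => t; rewrite /= !in_itv/=; exact: g_cvg.
- by apply: integrableZl => //; exact: integrable_abse.
- apply: aeW => t n; rewrite /= !in_itv/= => tx.
  rewrite /g_ /g /= lee_fin /psi_kernel mulr1 normrM mulrC ler_wpM2r//.
  by apply: fM => //; exact: leq_addl.
split => //; apply: cvgMr; rewrite -(cvg_shiftn N).
apply: fine_cvg.
by rewrite fineK//; apply: integrable_fin_num.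
Qed.

(** * Topology and order of the intervals from [a] to [b] *)

Section Intervals.
Context {R : realType} {a : R} {b : \bar R}.

Lemma interval_oo_open : open (interval_oo a b).
Proof.
case: b => [r| |].
- rewrite (_ : interval_oo _ _ = `]a, r[%classic); first exact: interval_open.
  apply/seteqP; split => t; rewrite /interval_oo /= in_itv/= lte_fin.
    by move=> [-> ->].
  by move=> /andP[].
- rewrite (_ : interval_oo _ _ = `]a, +oo[%classic); first exact: interval_open.
  apply/seteqP; split => t; rewrite /interval_oo /= in_itv/= ltry.
    by move=> [->].
  by rewrite andbT.
- rewrite (_ : interval_oo _ _ = set0); first exact: open0.
  by apply/seteqP; split => t // [_]; rewrite ltNge leNye.
Qed.

Lemma interval_oo_is_interval : is_interval (interval_oo a b).
Proof.
move=> p q [ap _] [_ qb] t /andP[pt tq].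
by split; [exact: lt_le_trans pt|apply: le_lt_trans qb; rewrite lee_fin].
Qed.

Lemma interval_ooW : interval_oo a b `<=` interval_cc a b.
Proof. by move=> t [at_ tb]; split; exact: ltW. Qed.

Lemma nbhs_interval_cc t : interval_oo a b t -> nbhs t (interval_cc a b).
Proof.
by move=> Jt; apply: filterS interval_ooW _; exact: interval_oo_open.
Qed.

Lemma interval_oo_bnd x t : interval_oo a b x -> a < t < x -> interval_oo a b t.
Proof.
move=> [_ xb] /andP[at_ tx]; split => //.
by apply: lt_trans xb; rewrite lte_fin.
Qed.

Lemma interval_cc_bnd x t : interval_oo a b x -> a <= t <= x ->
  interval_cc a b t.
Proof.
move=> [_ xb] /andP[at_ tx]; split => //.
by apply: ltW; apply: le_lt_trans xb; rewrite lee_fin.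
Qed.

End Intervals.

(** * Uniform convergence and passage to the limit *)

Lemma uniform_cvgn_dist {R : realType} {A : set R} {f_ : nat -> R -> R}
    {f : R -> R} : {uniform A, f_ @ \oo --> f} ->
  forall e, 0 < e -> \forall k \near \oo, forall t, A t -> `|f t - f_ k t| < e.
Proof.
move=> ff e e0; apply: (ff [set h | forall t, A t -> `|f t - h t| < e]).
apply/uniform_nbhs; exists [set xy | `|xy.1 - xy.2| < e]; split => //.
by rewrite -entourage_ballE; exists e.
Qed.

Theorem theorem10 (R : realType) (n : nat) (alpha : R)
  (halpha : n%:R - 1 < alpha < n%:R)
  (a : R) (b : \bar R) (hab : (a%:E < b)%E)
  (psi : R -> R)
  (psi_cont : {within interval_cc a b, continuous psi})
  (psi_incr : forall x y, interval_cc a b x -> interval_cc a b y ->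
     x < y -> psi x < psi y)
  (psi_derivable : forall x, interval_cc a b x ->
     derivable_within (interval_cc a b) psi x)
  (dpsi_cont : {within interval_cc a b,
     continuous (derive_within (interval_cc a b) psi)})
  (dpsi_neq0 : forall x, interval_cc a b x ->
     derive_within (interval_cc a b) psi x != 0)
  (f_ : nat -> R -> R)
  (f_cont : forall k, {within interval_cc a b, continuous (f_ k)})
  (f_cvg : exists f : R -> R, {uniform interval_cc a b, f_ @ \oo --> f})
  (Df_exists : forall k, psiRL_exists a psi n alpha (f_ k) (interval_oo a b))
  (Df_cvg : forall eps : R, 0 < eps -> exists g : R -> R,
     {uniform interval_co (a + eps) b,
        (fun k => psiRL a psi n alpha (f_ k)) @ \oo --> g}) :
  psiRL_exists a psi n alpha (fun t => limn (fun k => f_ k t))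
    (interval_oo a b) /\
  forall x, interval_oo a b x ->
    psiRL a psi n alpha (f_ k) x @[k --> \oo] -->
    psiRL a psi n alpha (fun t => limn (fun k => f_ k t)) x.
Proof.
set J := interval_oo a b; set I := interval_cc a b.
set mu := n%:R - alpha; set f := fun t => limn (fun k => f_ k t).
have mu0 : 0 < mu by rewrite subr_gt0; case/andP: halpha.
have psi_der x : J x -> is_derive x 1 psi (derive_within I psi x).
  move=> Jx; apply: derivable_within_interior; first exact: nbhs_interval_cc.
  by apply: psi_derivable; exact: interval_ooW.
have dpsi x : J x -> derivable psi x 1 by move=> /psi_der[].
have dpsiE x : J x -> derive1 psi x = derive_within I psi x.
  by move=> /psi_der[_ <-]; rewrite derive1E.
(* Monotonicity of [psi] gives [>= 0], and the nonvanishing of the derivative excludes 0. *)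
have dpsi_gt0 x : J x -> 0 < derive1 psi x.
  move=> Jx; rewrite lt_neqAle eq_sym dpsiE// dpsi_neq0 ?andTb; last first.
    exact: interval_ooW.
  rewrite -dpsiE//; apply: (@incr_derive1_ge0 _ _ J).
  - by move=> y; rewrite inE => /interior_subset; exact: dpsi.
  - move=> y z; rewrite !inE => Jy Jz; apply: psi_incr; exact: interval_ooW.
  - by rewrite /interior; exact: interval_oo_open.
have [f0 f0P] := f_cvg; have fdist := uniform_cvgn_dist f0P.
(* [limn] is total and meaningful only where the sequence converges; convergence to [f0] ensures
   this on [I]. *)
have fcvg t : I t -> f_ ^~ t @ \oo --> f t.
  move=> It; suff : cvgn (f_ ^~ t) by [].
  apply: (@cvgP _ _ (f0 t)); apply/cvgrPdist_lt => e e0.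
  by apply: filterS (fdist e e0) => k; exact.
(* [f_N] is bounded on the compact [[a, x]], and for [k >= N] both [f_k] and [f_N] are within 1 of
   [f0]. Every number above [M0] bounds [f_N], whence [M0 + 1]. *)
have f_bound x : J x -> exists N M, forall k t,
    (N <= k)%N -> a < t < x -> `|f_ k t| <= M.
  move=> Jx; have [N _ HN] := fdist 1 ltr01.
  have fNx : {within `[a, x], continuous (f_ N)}.
    apply: continuous_subspaceW (f_cont N) => t /=.
    by rewrite in_itv; exact: interval_cc_bnd.
  have /compact_bounded[M0 [_ HM]] :=
    continuous_compact fNx (@segment_compact _ _ _).
  exists N, (1 + 1 + (M0 + 1)) => k t Nk atx.
  have It : I t by apply: interval_ooW; exact: interval_oo_bnd atx.
  have fN : `|f_ N t| <= M0 + 1.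
    apply: (HM (M0 + 1)); first by rewrite ltrDl.
    by exists t => //=; rewrite in_itv/=; case/andP: atx => ? ?; rewrite !ltW.
  rewrite -(subrK (f_ N t) (f_ k t)) (le_trans (ler_normD _ _))// lerD//.
  rewrite -(subrK (f0 t) (f_ k t)) -addrA (le_trans (ler_normD _ _))// lerD//.
    by rewrite distrC ltW// HN.
  by rewrite ltW// (HN N)//=.
have integral_cvg x : J x ->
    lebesgue_measure.-integrable `]a, x[ (EFin \o psi_kernel psi mu f x) /\
    psi_integral a psi mu (f_ k) x @[k --> \oo] --> psi_integral a psi mu f x.
  move=> Jx; have [N [M fM]] := f_bound x Jx.
  apply: psi_integral_cvg _ _ _ fM.
  - apply: (psi_kernel1_integrable (dpsi := derive_within I psi)) => //.
    + by case: Jx.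
    + apply: continuous_subspaceW psi_cont => t /=.
      by rewrite in_itv; exact: interval_cc_bnd.
    + apply: continuous_subspaceW dpsi_cont => t /=.
      by rewrite in_itv; exact: interval_cc_bnd.
    + by move=> t atx; apply: psi_der; exact: interval_oo_bnd atx.
    + move=> t atx; have Jt := interval_oo_bnd _ _ Jx atx.
      by rewrite -dpsiE// ltW// dpsi_gt0.
    + move=> t /andP[at_ tx]; apply: psi_incr => //; last exact: interval_ooW.
      by apply: interval_cc_bnd Jx _; rewrite at_ ltW.
  - by move=> k; have [+ _] := Df_exists k; exact.
  - by move=> t atx; apply/fcvg/interval_ooW; exact: interval_oo_bnd atx.
(* With [eps = p - a], the interval [[a + eps, b[] starts at [p] and contains [[p, q]]. *)
have DJ : locally_uniform_cauchy (J := J) (fun k => psiRL a psi n alpha (f_ k)).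
  move=> p q e [ap _] [_ qb] e0.
  have pa0 : 0 < p - a by rewrite subr_gt0.
  have [g gP] := Df_cvg _ pa0.
  have [N _ HN] := uniform_cvgn_dist gP _ (divr_gt0 e0 (ltr0Sn R 1)).
  exists N => // m Nm k l mk ml x /andP[px xq].
  have Kx : interval_co (a + (p - a)) b x.
    by split; [rewrite subrKC|apply: le_lt_trans qb; rewrite lee_fin].
  rewrite -(subrK (g x) (psiRL a psi n alpha (f_ k) x)) -addrA.
  rewrite (le_trans (ler_normD _ _))// (splitr e) lerD//.
    by rewrite distrC ltW// HN//=; exact: leq_trans mk.
  by rewrite ltW// HN//=; exact: leq_trans ml.
have [Dex Dlim] := iter_psi_diff_limit interval_oo_open interval_oo_is_interval
  dpsi dpsi_gt0 n _ _ (fun k => (Df_exists k).2)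
  (fun x Jx => (integral_cvg x Jx).2) DJ.
split; last exact: Dlim.
by split => // x Jx; have [] := integral_cvg x Jx.
Qed.
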